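(* Let $k$ be a field of characteristic $p>0$, $G$ a finite $p$-group and $A$ a $G$-algebra. Then $A$ is trace-surjective if and only if $A^G\le A$ is a Galois-extension in the sense of Chase–Harrison–Rosenberg.
   Context: All group actions are right actions. A $G$-algebra is a commutative $k$-algebra $A$ on which $G$ acts by $k$-algebra automorphisms; $A$ is trace-surjective if the map $\mathrm{tr}:A\to A^G$, $a\mapsto\sum_{g\in G}ag$, is surjective. With $R:=A^G$, the extension $R\le A$ is called a Galois-extension (Chase–Harrison–Rosenberg) if one of the following equivalent conditions holds: (1) there are elements $x_1,\dots,x_m,y_1,\dots,y_m\in A$ such that $\sum_{i=1}^m x_i\,(y_i)\sigma=\delta_{1,\sigma}$ for all $\sigma\in G$; (2) for every $1\ne\sigma\in G$ and every maximal ideal $\mathfrak p$ of $A$ there is $a\in A$ with $a-(a)\sigma\notin\mathfrak p$. *)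

(* Defs.v *)
From HB Require Import structures.
From mathcomp Require Import all_boot all_order all_algebra.
From mathcomp Require Import all_fingroup all_solvable.

Set Implicit Arguments.
Unset Strict Implicit.
Unset Printing Implicit Defensive.

Import GRing.Theory.
Local Open Scope ring_scope.

(* A commutative k-algebra is a commutative ring A with a structure morphism
   iota : k -> A; unlike [comAlgType k], this includes the zero algebra.
   MathComp actions are right actions: [to a g] is the element a g, with
   a (g h) = (a g) h.  Bijectivity of each [to^~ g] is part of [action], and
   fixing the image of iota is k-linearity for a ring morphism. *)
Definition is_Galgebra (k : fieldType) (A : comPzRingType)
    (iota : {rmorphism k -> A}) (gT : finGroupType) (G : {group gT})
    (to : action G A) : Prop :=
  forall g, g \in G ->
    [/\ {morph to^~ g : a b / a + b},
        {morph to^~ g : a b / a * b},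
        to 1 g = 1
      & forall c : k, to (iota c) g = iota c].

Section InvariantsTraceGalois.

Variables (A : comPzRingType) (gT : finGroupType) (G : {group gT}).
Variable to : action G A.

(* Membership in the invariant ring A^G; ['Fix_to(G)] needs a finite A. *)
Definition is_invariant (a : A) : Prop := forall g, g \in G -> to a g = a.

Definition trace (a : A) : A := \sum_(g in G) to a g.

Definition trace_surjective : Prop :=
  forall b, is_invariant b -> exists a, trace a = b.

(* Chase-Harrison-Rosenberg: A^G <= A is a Galois extension, i.e. there are
   x_i, y_i with sum_i x_i (y_i)sigma = delta_(1, sigma). *)
Definition CHR_Galois : Prop :=
  exists (m : nat) (x y : 'I_m -> A),
    forall sigma, sigma \in G ->
      \sum_(i < m) x i * to (y i) sigma = (sigma == 1%g)%:R.

End InvariantsTraceGalois.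

(* Main.v *)
Require Import Defs.
From HB Require Import structures.
From mathcomp Require Import all_boot all_order all_algebra.
From mathcomp Require Import all_fingroup all_solvable.

(** Let R = A^G, and let tr be the trace.

    If R <= A is Galois, the Galois coordinates x_i, y_i are a dual basis:
    a = sum_i x_i tr(y_i a) for every a in A.  Thus A is generated over R by the
    x_i and A = I A for the ideal I = tr(A) of R.  The determinant trick behind
    Nakayama's lemma ([trace_eq1_of_CHR_Galois]) then produces an element of
    1 + I that annihilates A, hence is 0; so 1 lies in I, and tr, being
    R-linear, is onto R.  This holds for every finite group.

    If tr(a) = 1, the p-group hypothesis enters through the fact that the order
    of each s <> 1 vanishes in A.  On every left coset of <s>, number the
    elements cyclically so that right multiplication by s raises the number by
    1; weighting the summands of tr(a) by these numbers gives an element c with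
    c - (c)s = 1 ([exists_sub_act_eq1]).  With one such c_s for each s <> 1, the
    function t |-> prod_(s <> 1) ((c_s)t - (c_s)s) on G is the delta function at
    1: at t = 1 all factors are 1, and at t <> 1 the factor with s = t vanishes.
    Expanding the product puts it in the form sum_i x_i (y_i)t
    ([act_representableM]), which is the Galois condition. *)

Import GRing.Theory.
Local Open Scope ring_scope.

(** * Actions by ring automorphisms *)

Section RingAction.

Variables (A : comPzRingType) (gT : finGroupType) (G : {group gT}).
Variable to : action G A.

Definition ring_action : Prop :=
  forall g, g \in G ->
    [/\ {morph to^~ g : a b / a + b}, {morph to^~ g : a b / a * b}
      & to 1 g = 1].

Hypothesis toR : ring_action.

Lemma ractD g a b : g \in G -> to (a + b) g = to a g + to b g.
Proof. by case/toR. Qed.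

Lemma ractM g a b : g \in G -> to (a * b) g = to a g * to b g.
Proof. by case/toR. Qed.

Lemma ract1 g : g \in G -> to 1 g = 1.
Proof. by case/toR. Qed.

Lemma ract0 g : g \in G -> to 0 g = 0.
Proof. by move=> Gg; apply: (addrI (to 0 g)); rewrite -ractD // !addr0. Qed.

Lemma ractN g a : g \in G -> to (- a) g = - to a g.
Proof.
by move=> Gg; apply: (addrI (to a g)); rewrite -ractD // !subrr ract0.
Qed.

Lemma ract_sum I (r : seq I) (P : pred I) (F : I -> A) g : g \in G ->
  to (\sum_(i <- r | P i) F i) g = \sum_(i <- r | P i) to (F i) g.
Proof.
move=> Gg; apply: (big_morph (to^~ g)); last exact: ract0.
by move=> a b; apply: ractD.
Qed.

Lemma ractMn g a n : g \in G -> to (a *+ n) g = to a g *+ n.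
Proof.
by move=> Gg; elim: n => [|n IHn]; rewrite ?mulr0n ?ract0 // !mulrS ractD ?IHn.
Qed.

Lemma ract_mul a g h : g \in G -> h \in G -> to a (g * h)%g = to (to a g) h.
Proof.
have [_ actM]: is_action G to by case: (to).
exact: actM.
Qed.

Lemma ract_id a : to a 1%g = a.
Proof.
have [actI _]: is_action G to by case: (to).
by apply: (actI 1%g); rewrite /= -ract_mul ?mulg1.
Qed.

(** * The trace ideal *)

Lemma is_invariant1 : is_invariant to 1.
Proof. by move=> g; apply: ract1. Qed.

Lemma is_invariantD a b :
  is_invariant to a -> is_invariant to b -> is_invariant to (a + b).
Proof. by move=> Ra Rb g Gg; rewrite ractD // Ra // Rb. Qed.

Lemma is_invariantN a : is_invariant to a -> is_invariant to (- a).
Proof. by move=> Ra g Gg; rewrite ractN // Ra. Qed.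

Lemma is_invariantM a b :
  is_invariant to a -> is_invariant to b -> is_invariant to (a * b).
Proof. by move=> Ra Rb g Gg; rewrite ractM // Ra // Rb. Qed.

Lemma is_invariant_trace a : is_invariant to (trace to a).
Proof.
move=> g Gg; rewrite /trace ract_sum // [RHS](reindex_inj (mulIg g)) /=.
apply: eq_big => [h | h Gh]; first by rewrite groupMr.
by rewrite ract_mul.
Qed.

Lemma traceD a b : trace to (a + b) = trace to a + trace to b.
Proof.
by rewrite /trace -big_split /=; apply: eq_bigr => g Gg; rewrite ractD.
Qed.

Lemma traceN a : trace to (- a) = - trace to a.
Proof. by rewrite /trace -sumrN; apply: eq_bigr => g Gg; rewrite ractN. Qed.

Lemma traceMr a b : is_invariant to b -> trace to (a * b) = trace to a * b.
Proof.
move=> Rb; rewrite /trace big_distrl /=.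
by apply: eq_bigr => g Gg; rewrite ractM // Rb.
Qed.

Lemma trace_surjective_of_eq1 a : trace to a = 1 -> trace_surjective to.
Proof. by move=> tra1 b Rb; exists (a * b); rewrite traceMr // tra1 mul1r. Qed.

(** Since the image of the trace is an ideal of the invariant ring, this is a
    congruence of that ring; it stands for equality in a quotient ring that
    need not be constructed. *)
Definition trace_congr a b : Prop :=
  [/\ is_invariant to a, is_invariant to b & exists c, a = b + trace to c].

Lemma trace_congr_refl a : is_invariant to a -> trace_congr a a.
Proof.
by move=> Ra; split=> //; exists (a - a); rewrite traceD traceN subrr addr0.
Qed.

Lemma trace_congrD a b a' b' :
  trace_congr a b -> trace_congr a' b' -> trace_congr (a + a') (b + b').
Proof.
move=> [Ra Rb [c Dc]] [Ra' Rb' [c' Dc']]; split; try exact: is_invariantD.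
by exists (c + c'); rewrite traceD Dc Dc' addrACA.
Qed.

Lemma trace_congrM a b a' b' :
  trace_congr a b -> trace_congr a' b' -> trace_congr (a * a') (b * b').
Proof.
move=> [Ra Rb [c Dc]] [Ra' Rb' [c' Dc']]; split; try exact: is_invariantM.
exists (c * a' + c' * b); rewrite traceD !traceMr //.
by rewrite {1}Dc mulrDl {1}Dc' mulrDr -addrA (addrC (_ * a')) (mulrC b (trace _ _)).
Qed.

Lemma trace_congr_det n (M N : 'M[A]_n) :
  (forall i j, trace_congr (M i j) (N i j)) -> trace_congr (\det M) (\det N).
Proof.
have congr0: trace_congr 0 0.
  by apply: trace_congr_refl => g; apply: ract0.
have congr1: trace_congr 1 1 by apply/trace_congr_refl/is_invariant1.
move=> MN; rewrite /determinant.
apply: (big_ind2 trace_congr) => // [a b a' b'|s _]; first exact: trace_congrD.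
apply: trace_congrM.
  apply: trace_congr_refl; case: (odd_perm s); last exact: is_invariant1.
  by rewrite expr1; apply/is_invariantN/is_invariant1.
by apply: (big_ind2 trace_congr) => // a b a' b'; apply: trace_congrM.
Qed.

(** * Galois extensions have an element of trace 1 *)

Lemma CHR_dual_basis m (x y : 'I_m -> A) :
    (forall s, s \in G -> \sum_(i < m) x i * to (y i) s = (s == 1%g)%:R) ->
  forall a, a = \sum_(i < m) x i * trace to (y i * a).
Proof.
move=> xy a.
under eq_bigr do rewrite /trace big_distrr /=.
rewrite exchange_big /= (bigD1 1%g) //= [X in _ + X]big1 => [|s /andP[Gs nts]].
  under eq_bigr do rewrite ractM // mulrA.
  by rewrite -big_distrl /= xy // eqxx mul1r ract_id addr0.
under eq_bigr do rewrite ractM // mulrA.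
by rewrite -big_distrl /= xy // (negPf nts) mul0r.
Qed.

(** With M i j = tr(y_i x_j), the dual basis formula says that the row vector
    of the x_i is killed by 1 - M, hence by its determinant d.  As
    1 = sum_i x_i y_i, this forces d = 0, whereas d is congruent to det 1 = 1
    modulo traces. *)
Lemma trace_eq1_of_CHR_Galois : CHR_Galois to -> exists a, trace to a = 1.
Proof.
case=> m [x [y xy]].
pose M : 'M[A]_m := \matrix_(i, j) trace to (y i * x j).
pose X : 'rV[A]_m := \row_i x i.
have XM: X *m (1%:M - M) = 0.
  apply/rowP=> j; rewrite mulmxBr mulmx1 !mxE {1}[x j](CHR_dual_basis _ _ _ xy).
  by apply/eqP; rewrite subr_eq0; apply/eqP/eq_bigr => i _; rewrite !mxE.
have xd j : x j * \det (1%:M - M) = 0.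
  have: X *m ((1%:M - M) *m \adj (1%:M - M)) = 0 by rewrite mulmxA XM mul0mx.
  by rewrite mul_mx_adj mul_mx_scalar => /rowP/(_ j); rewrite !mxE mulrC.
have d0: \det (1%:M - M) = 0.
  move: (\det _) xd => d xd; have := xy 1%g (group1 G); rewrite eqxx => one.
  rewrite -[d]mul1r -[1]one big_distrl /= big1 // => i _.
  by rewrite mulrAC xd mul0r.
have /trace_congr_det: forall i j, trace_congr ((1%:M - M) i j) (1%:M i j).
  move=> i j; rewrite !mxE.
  have R1: is_invariant to (i == j)%:R.
    by case: (i == j); [apply: is_invariant1 | move=> g; apply: ract0].
  split=> //; last by exists (- (y i * x j)); rewrite traceN.
  exact/is_invariantD/is_invariantN/is_invariant_trace.
case=> _ _ [c]; rewrite d0 det1 => c1; exists (- c).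
by rewrite traceN; apply/eqP; rewrite eq_sym -addr_eq0 -c1.
Qed.

(** * From an element of trace 1 to Galois coordinates *)

(** Each g is r s^i, where r is a representative of its left coset modulo the
    cycle generated by s; right multiplication by s keeps r and increments i. *)
Lemma exists_cycle_index (s : gT) :
  exists w : gT -> nat, forall g, w (g * s)%g = (w g).+1 %[mod #[s]%g].
Proof.
pose r g := repr (g *: <[s]>)%g.
have ex g : exists i, ((r g)^-1 * g == s ^+ i)%g.
  have := mem_repr g (lcoset_refl <[s]>%G g); rewrite -/(r g) => rg.
  move: rg; rewrite lcoset_sym mem_lcoset => /cycleP[i Di].
  by exists i; rewrite Di.
exists (fun g => xchoose (ex g)) => g; apply/eqP; rewrite -eq_expg_mod_order.
have /eqP <- := xchooseP (ex (g * s)%g).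
have rs: r (g * s)%g = r g.
  by rewrite /r lcosetM (lcoset_id (cycle_id s)).
by rewrite expgSr -(eqP (xchooseP (ex g))) rs mulgA.
Qed.

(** The coefficient of (a)g in (c)s is the index of g s^-1, one less modulo the
    order of s than the coefficient in c; so c - (c)s = tr(a). *)
Lemma exists_sub_act_eq1 s a :
    s \in G -> (#[s]%g)%:R = 0 :> A -> trace to a = 1 ->
  exists c, c - to c s = 1.
Proof.
move=> Gs s0 tra1; have [w wS] := exists_cycle_index s.
have natA n : n%:R = (n %% #[s]%g)%:R :> A.
  by rewrite {1}(divn_eq n #[s]%g) natrD natrM s0 mulr0 add0r.
exists (\sum_(g in G) to a g *+ w g); rewrite ract_sum //.
rewrite [X in X - _](reindex_inj (mulIg s)) /=.
under eq_bigl do rewrite groupMr //.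
rewrite -sumrB -[RHS]tra1 /trace [RHS](reindex_inj (mulIg s)) /=.
apply: eq_big => [g|g Gg]; first by rewrite groupMr.
rewrite ractMn // -ract_mul // -[_ *+ w g]mulr_natr -[_ *+ w (g * s)%g]mulr_natr.
have ->: (w (g * s)%g)%:R = (w g).+1%:R :> A by rewrite natA wS -natA.
by rewrite -mulrBr mulrS addrK mulr1.
Qed.

(** Functions on G of the form demanded by the Galois condition: the image of
    the tensor square of A in the ring of functions from G to A. *)
Definition act_representable (F : gT -> A) : Prop :=
  exists r : seq (A * A),
    forall t, t \in G -> F t = \sum_(z <- r) z.1 * to z.2 t.

Lemma act_representable1 : act_representable (fun=> 1).
Proof. by exists [:: (1, 1)] => t Gt; rewrite big_seq1 ract1 // mulr1. Qed.

(** This is the image of the tensor c (x) 1 - 1 (x) d. *)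
Lemma act_representable_sub c d : act_representable (fun t => to c t - d).
Proof.
exists [:: (1, c); (- d, 1)] => t Gt.
by rewrite big_cons big_seq1 /= ract1 // mul1r mulr1.
Qed.

Lemma act_representableM F1 F2 :
    act_representable F1 -> act_representable F2 ->
  act_representable (fun t => F1 t * F2 t).
Proof.
move=> [r1 D1] [r2 D2].
exists [seq (z1.1 * z2.1, z1.2 * z2.2) | z1 <- r1, z2 <- r2] => t Gt.
rewrite big_allpairs_dep D1 // D2 // big_distrl; apply: eq_bigr => z1 _.
by rewrite big_distrr; apply: eq_bigr => z2 _; rewrite /= ractM // mulrACA.
Qed.

Lemma eq_act_representable F1 F2 :
    {in G, F1 =1 F2} -> act_representable F1 -> act_representable F2.
Proof. by move=> F12 [r Dr]; exists r => t Gt; rewrite -F12 // Dr. Qed.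

Lemma act_representable_prod I (r : seq I) (P : pred I) (F : I -> gT -> A) :
    (forall i, act_representable (F i)) ->
  act_representable (fun t => \prod_(i <- r | P i) F i t).
Proof.
move=> FR; elim: r => [|i r IHr].
  apply: (eq_act_representable (fun=> 1)) act_representable1 => t _.
  by rewrite big_nil.
case Pi: (P i); last first.
  by apply: eq_act_representable IHr => t _; rewrite big_cons Pi.
apply: eq_act_representable (act_representableM _ _ (FR i) IHr) => t _.
by rewrite big_cons Pi.
Qed.

Lemma CHR_Galois_of_representable :
  act_representable (fun t => (t == 1%g)%:R) -> CHR_Galois to.
Proof.
case=> r Dr; exists (size r).
exists (fun i => (tnth (in_tuple r) i).1), (fun i => (tnth (in_tuple r) i).2).
by move=> s Gs; rewrite Dr // [RHS]big_tnth.
Qed.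

(** The delta function at 1 is the product over s <> 1 of the representable
    functions t |-> (c_s)t - (c_s)s. *)
Lemma CHR_Galois_of_sub_act_eq1 :
    (forall s, s \in G -> s != 1%g -> exists c, c - to c s = 1) ->
  CHR_Galois to.
Proof.
move=> exc; apply: CHR_Galois_of_representable.
have /fin_all_exists[c Dc]: forall s, exists c,
    (s \in G) && (s != 1%g) -> c - to c s = 1.
  move=> s; have [/andP[Gs nts] | _] := boolP (_ && _); last by exists 0.
  by have [c Dc] := exc s Gs nts; exists c.
apply: eq_act_representable
  (act_representable_prod _ (index_enum gT) (fun s => (s \in G) && (s != 1%g))
    (fun s t => to (c s) t - to (c s) s) _) => [t Gt | s].
  have [-> | nt1] := eqVneq t 1%g.
    by rewrite big1 // => s /Dc; rewrite ract_id.
  by rewrite (bigD1 t) ?Gt //= subrr mul0r.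
exact: act_representable_sub.
Qed.

End RingAction.

(** * Finite p-groups in characteristic p *)

Theorem proposition4p4 (k : fieldType) (p : nat) (hp : p \in [pchar k])
    (gT : finGroupType) (G : {group gT}) (hG : (p.-group G)%g)
    (A : comPzRingType) (iota : {rmorphism k -> A})
    (to : action G A) (hA : is_Galgebra iota to) :
  trace_surjective to <-> CHR_Galois to.
Proof.
have toR: ring_action _ _ _ to by move=> g /hA[].
split=> [trS | /(trace_eq1_of_CHR_Galois _ _ _ _ toR)[a tra1]]; last first.
  exact: (trace_surjective_of_eq1 _ _ _ _ toR) tra1.
have [a tra1] := trS 1 (is_invariant1 _ _ _ _ toR).
have pA0: p%:R = 0 :> A by rewrite -(rmorph_nat iota) (pcharf0 hp) rmorph0.
apply: (CHR_Galois_of_sub_act_eq1 _ _ _ _ toR) => s Gs nts.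
apply: (exists_sub_act_eq1 _ _ _ _ toR) tra1 => //.
have [[|n] Dn] := p_natP (mem_p_elt hG Gs).
  by rewrite -order_eq1 Dn in nts.
by rewrite Dn expnS natrM pA0 mul0r.
Qed.
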